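(* There are absolute thresholds $\bar C\ge2$ and $\bar c>0$ such that, for any fixed absolute constants $C_{\log}\ge\bar C$ and $0<c_{\rm reg}\le\bar c$, the following holds. For every fixed $c\ge1$ there exist constants $C_0,C_1,c_0,n_0>0$ such that for every fixed $0<\beta<1/2$ and any sequence of parameters $(n,M,\mu,R,\varepsilon,T)$ (sequence index suppressed) with $n\to\infty$, $n\ge n_0$, $M,\mu,R>0$, $$M\ge C_1\mu R,\qquad 0<\varepsilon<c_0\mu R^2,\qquad \mathfrak A_c(M,\mu,\varepsilon,n)\le c_{\rm reg},$$ and $$T=o\left[\left(\frac{nM}{\sqrt{\mu\varepsilon}}\right)^c\right],$$ one has, for all sufficiently late members of the sequence, $$\Delta_{\mathcal F_{\rm LipSC}^{M,\mu}(B_R)}(\varepsilon,\beta,T)\le C_0\,\mathcal R_c\left(C_1\varepsilon;M,2\sqrt{\frac{\varepsilon}{\mu}},n\right).$$ Equivalently, up to constants and logarithmic factors (powers of $\log(nM/\sqrt{\mu\varepsilon})$), $$\Delta_{\mathcal F_{\rm LipSC}^{M,\mu}(B_R)}(\varepsilon,\beta,T)\lesssim\max\left\{\frac{\sqrt\mu\,\varepsilon^{3/2}}{\sqrt n\,M},\frac{\varepsilon}{n}\right\}.$$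
   Context: $B_R=\{x\in\mathbb R^n:\|x\|_2\le R\}$. $\mathcal F_{\rm LipSC}^{M,\mu}(B_R)$ is the class of convex $M$-Lipschitz functions $f:B_R\to\mathbb R$ that are $\mu$-strongly convex, i.e. $f(y)\ge f(x)+\langle s_x,y-x\rangle+\frac\mu2\|y-x\|_2^2$ for $x,y\in B_R$, $s_x\in\partial f(x)$. Noisy oracle: for $f:S\to\mathbb R$, $S\subset\mathbb R^n$, $\delta\ge0$, let $\mathsf O_\delta(f)=\{O:S\to\mathbb R:\ \sup_{x\in S}|O(x)-f(x)|\le\delta\}$. Solvability: algorithms query points of $S$ and output a point of $S$. A randomized adaptive algorithm $A$ making at most $T$ oracle calls $(\varepsilon,\beta,\delta,T)$-solves a class $\mathcal F$ of functions on $S$ if for every $f\in\mathcal F$ and every deterministic oracle $O\in\mathsf O_\delta(f)$ its output $A^O$ satisfies $\mathbb P_A\{f(A^O)-\inf_S f\le\varepsilon\}\ge1-\beta$, the probability being over the internal randomness of $A$ (deterministic adaptive algorithms are included). The maximum admissible level of noise is $\Delta_{\mathcal F}(\varepsilon,\beta,T)=\sup\{\delta:\ \text{there is }A\text{ that }(\varepsilon,\beta,\delta,T)\text{-solves }\mathcal F\}$. For $c\ge1$, $$\mathcal R_c(\varepsilon;M,D,n)=\max\left\{\frac{\varepsilon^2}{\sqrt n\,MD},\frac{\varepsilon}{n}\right\}\left(13c\log\frac{nMD}{\varepsilon}\right)^2,$$ $$\mathfrak A_c(M,\mu,\varepsilon,n)=\left(13c\log\frac{C_{\log}nM}{\sqrt{\mu\varepsilon}}\right)^2\max\left\{\frac{\sqrt{\mu\varepsilon}}{\sqrt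 n\,M},\frac1n\right\}.$$ Convention: $T=o(Q)$ means $T/Q\to0$ along the sequence of parameters. All constants are independent of the particular sequence. *)

(* Defs.v *)
From HB Require Import structures.
From mathcomp Require Import all_boot all_order all_algebra.
From mathcomp Require Import all_classical all_reals all_analysis.

Set Implicit Arguments.
Unset Strict Implicit.
Unset Printing Implicit Defensive.

Import Order.TTheory GRing.Theory Num.Theory.
Import numFieldNormedType.Exports.

Local Open Scope classical_set_scope.
Local Open Scope ring_scope.

(* The norm that the library puts on 'rV[R]_n is the sup norm, so the Euclidean
   structure of R^n is set up by hand. *)
Definition dotp (R : realType) (n : nat) (x y : 'rV[R]_n) : R :=
  \sum_(i < n) x 0 i * y 0 i.

Definition norm2 (R : realType) (n : nat) (x : 'rV[R]_n) : R :=
  Num.sqrt (dotp x x).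

Definition ball2 (R : realType) (n : nat) (r : R) : set 'rV[R]_n :=
  [set x | norm2 x <= r].

(* A function f : S -> R is represented by a total function of which only the
   values on S are ever constrained or used. *)

Definition lipschitz2 (R : realType) (n : nat) (S : set 'rV[R]_n) (M : R)
    (f : 'rV[R]_n -> R) : Prop :=
  forall x y, S x -> S y -> `|f x - f y| <= M * norm2 (x - y).

(* Subdifferential of f as a function on S: the subgradient inequality is
   required against the points of S only. *)
Definition subdiff (R : realType) (n : nat) (S : set 'rV[R]_n)
    (f : 'rV[R]_n -> R) (x : 'rV[R]_n) : set 'rV[R]_n :=
  [set s | forall y, S y -> f x + dotp s (y - x) <= f y].

Definition strongly_convex (R : realType) (n : nat) (S : set 'rV[R]_n) (mu : R)
    (f : 'rV[R]_n -> R) : Prop :=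
  forall x y s, S x -> S y -> subdiff S f x s ->
    f x + dotp s (y - x) + mu / 2 * norm2 (y - x) ^+ 2 <= f y.

Definition LipSC (R : realType) (n : nat) (M mu r : R) :
    set ('rV[R]_n -> R) :=
  [set f | [/\ convex_function (@ball2 R n r) f,
               lipschitz2 (@ball2 R n r) M f
             & strongly_convex (@ball2 R n r) mu f]].

Definition noisy_oracles (R : realType) (X : Type) (S : set X) (delta : R)
    (f : X -> R) : set (X -> R) :=
  [set O | forall x, S x -> `|O x - f x| <= delta].

(* Deterministic adaptive algorithms as decision trees: either stop with an
   output, or query a point and continue according to the answer received. *)
Inductive algorithm (R : realType) (X : Type) : Type :=
| Output of X
| Query of X & (R -> algorithm R X).

Fixpoint run (R : realType) (X : Type) (O : X -> R) (A : algorithm R X) : X :=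
  match A with
  | Output x => x
  | Query x next => run O (next (O x))
  end.

(* At most T queries on every branch, all queries and outputs being in S. *)
Fixpoint valid_algorithm (R : realType) (X : Type) (S : set X) (T : nat)
    (A : algorithm R X) : Prop :=
  match A, T with
  | Output x, _ => S x
  | Query _ _, 0%N => False
  | Query x next, T'.+1 => S x /\ forall y, valid_algorithm S T' (next y)
  end.

(* A randomized algorithm is a random choice of a deterministic one. *)
Record randomized_algorithm (R : realType) (X : Type) : Type :=
  RandomizedAlgorithm {
    ra_display : measure_display;
    ra_space : measurableType ra_display;
    ra_prob : probability ra_space R;
    ra_tree : ra_space -> algorithm R X
  }.

Definition success (R : realType) (X : Type) (S : set X) (eps : R)
    (f O : X -> R) (A : randomized_algorithm R X) : set (ra_space A) :=
  [set w | f (run O (ra_tree w)) - inf (f @` S) <= eps].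
Arguments success {R X} S eps f O A.

(* Measurability is only asked of the events whose probability the definition
   mentions; jointly measurable decision trees would form a smaller class of
   algorithms. *)
Definition solves (R : realType) (X : Type) (S : set X) (F : set (X -> R))
    (eps beta delta : R) (T : nat) (A : randomized_algorithm R X) : Prop :=
  (forall w : ra_space A, valid_algorithm S T (ra_tree w)) /\
  forall f O, F f -> noisy_oracles S delta f O ->
    measurable (success S eps f O A) /\
    ((1 - beta)%:E <= ra_prob A (success S eps f O A))%E.

(* Extended-real valued, the supremum being -oo if no noise level is admissible
   and +oo if all are. *)
Definition max_noise (R : realType) (X : Type) (S : set X) (F : set (X -> R))
    (eps beta : R) (T : nat) : \bar R :=
  ereal_sup [set delta%:E | delta in [set delta : R |
    0 <= delta /\
    exists A : randomized_algorithm R X, solves S F eps beta delta T A]].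

Definition calR (R : realType) (c eps M D : R) (n : nat) : R :=
  Num.max (eps ^+ 2 / (Num.sqrt n%:R * M * D)) (eps / n%:R)
  * (13 * c * ln (n%:R * M * D / eps)) ^+ 2.

Definition frakA (R : realType) (Clog c M mu eps : R) (n : nat) : R :=
  (13 * c * ln (Clog * n%:R * M / Num.sqrt (mu * eps))) ^+ 2
  * Num.max (Num.sqrt (mu * eps) / (Num.sqrt n%:R * M)) (n%:R^-1).

(* Main.v *)
Require Import Defs.
From HB Require Import structures.
From mathcomp Require Import all_boot all_order all_algebra.
From mathcomp Require Import all_classical all_reals all_analysis.
From mathcomp Require Import measurable_realfun ring lra.

Import Order.TTheory GRing.Theory Num.Theory.
Import numFieldNormedType.Exports.

Local Open Scope classical_set_scope.
Local Open Scope ring_scope.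

(** Put s = sqrt (mu eps) and D = sqrt (eps / mu), so that eps = s D. For a unit
vector v let N_v be the support function of the part of the unit ball where
|<v,u>| <= tau, so that N_v (y) = |y| as soon as |<v,y>| <= tau |y|, while
N_v (v) <= tau. The convex function
  f_v (y) = max (- 4 s <v,y>, - 4 eps + kap N_v (y)) + mu / 2 |y|^2
satisfies f_v (D v) <= - 5/2 eps, but wherever |<v,y>| <= tau |y| it is within
32 s tau eps / kap of max (0, - 4 eps + kap |y|) + mu / 2 |y|^2, which does not
depend on v. An oracle with that much noise hides v. For v uniform among the
sign vectors scaled by 1 / sqrt n, a given point violates |<v,y>| <= tau |y|
with probability at most 2 exp (- n tau^2 / 8). With Q = n M / s and
tau^2 = 8 c log Q / n this is 2 Q^-c, so T = o (Q^c) queries most likely miss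
v. The noise is least for the largest admissible slope
kap = min (M / 4, s / tau); the two cases of this minimum are the two terms of
the maximum in the rate. *)

(** * Euclidean structure and strong convexity *)

Section Euclidean.
Context {R : realType} {n : nat}.
Implicit Types (x y z : 'rV[R]_n) (a t : R).

Lemma dotpC x y : dotp x y = dotp y x.
Proof. by apply: eq_bigr => i _; rewrite mulrC. Qed.

Lemma dotpDr x y z : dotp x (y + z) = dotp x y + dotp x z.
Proof. by rewrite -big_split; apply: eq_bigr => i _; rewrite mxE mulrDr. Qed.

Lemma dotpZr a x y : dotp x (a *: y) = a * dotp x y.
Proof. by rewrite mulr_sumr; apply: eq_bigr => i _; rewrite mxE mulrCA. Qed.

Lemma dotpNr x y : dotp x (- y) = - dotp x y.
Proof. by rewrite -scaleN1r dotpZr mulN1r. Qed.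

Lemma dotp0r x : dotp x 0 = 0.
Proof. by rewrite -(scale0r 0) dotpZr mul0r. Qed.

Lemma dotpDl x y z : dotp (x + y) z = dotp x z + dotp y z.
Proof. by rewrite dotpC dotpDr !(dotpC z). Qed.

Lemma dotpZl a x y : dotp (a *: x) y = a * dotp x y.
Proof. by rewrite dotpC dotpZr dotpC. Qed.

Lemma dotpNl x y : dotp (- x) y = - dotp x y.
Proof. by rewrite dotpC dotpNr dotpC. Qed.

Definition dotpE := (dotpDl, dotpDr, dotpNl, dotpNr, dotpZl, dotpZr).

Lemma dotp_ge0 x : 0 <= dotp x x.
Proof. by apply: sumr_ge0 => i _; rewrite -expr2 sqr_ge0. Qed.

Lemma norm2_ge0 x : 0 <= norm2 x.
Proof. exact: sqrtr_ge0. Qed.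

Lemma sqr_norm2 x : norm2 x ^+ 2 = dotp x x.
Proof. by rewrite sqr_sqrtr // dotp_ge0. Qed.

Lemma norm2Z a x : norm2 (a *: x) = `|a| * norm2 x.
Proof. by rewrite /norm2 !dotpE mulrA -expr2 sqrtrM ?sqr_ge0// sqrtr_sqr. Qed.

Lemma norm2N x : norm2 (- x) = norm2 x.
Proof. by rewrite /norm2 !dotpE opprK. Qed.

Lemma norm20 : norm2 (0 : 'rV[R]_n) = 0.
Proof. by rewrite /norm2 dotp0r sqrtr0. Qed.

Lemma norm2_eq0 x : norm2 x = 0 -> x = 0.
Proof.
move=> /eqP; rewrite sqrtr_eq0 => x0.
have {x0} /eqP : dotp x x = 0 by apply/eqP; rewrite eq_le x0 dotp_ge0.
rewrite psumr_eq0 => [/allP xi0|i _]; last by rewrite -expr2 sqr_ge0.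
apply/rowP => i; rewrite mxE.
by have /xi0 := mem_index_enum i; rewrite /= mulf_eq0 orbb => /eqP.
Qed.

(** Cauchy-Schwarz: the squared norm of [dotp y y *: x - dotp x y *: y] is [dotp y y] times the
    defect of the squared inequality. *)
Lemma dotp_le_norm2 x y : `|dotp x y| <= norm2 x * norm2 y.
Proof.
have [y0|y0] := eqVneq (norm2 y) 0.
  by rewrite y0 mulr0 (norm2_eq0 y y0) dotp0r normr0.
rewrite -(ler_pXn2r (_ : 0 < 2)%N) ?nnegrE ?mulr_ge0 ?norm2_ge0//.
rewrite exprMn !sqr_norm2 real_normK ?num_real//.
have yy : 0 < dotp y y by rewrite -sqr_norm2 exprn_gt0// lt_def y0 norm2_ge0.
have := dotp_ge0 (dotp y y *: x - dotp x y *: y).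
rewrite !dotpE (dotpC y x) -(pmulr_rge0 _ yy) => h.
rewrite -subr_ge0 -(pmulr_rge0 _ yy) -(pmulr_rge0 _ yy).
by apply: le_trans h _; rewrite le_eqVlt; apply/orP; left; apply/eqP; ring.
Qed.

Lemma dotp_le x y : dotp x y <= norm2 x * norm2 y.
Proof. exact: le_trans (ler_norm _) (dotp_le_norm2 _ _). Qed.

Lemma norm2D x y : norm2 (x + y) <= norm2 x + norm2 y.
Proof.
rewrite -(ler_pXn2r (_ : 0 < 2)%N) ?nnegrE ?addr_ge0 ?norm2_ge0//.
rewrite sqrrD !sqr_norm2 !dotpE (dotpC y x).
by have := dotp_le x y; lra.
Qed.

Lemma ball2_conv r x y t : 0 <= t <= 1 -> ball2 r x -> ball2 r y ->
  ball2 r (t *: x + (1 - t) *: y).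
Proof.
move=> /andP[t0 t1] /= xr yr; apply: le_trans (norm2D _ _) _.
rewrite !norm2Z !ger0_norm ?subr_ge0//.
have -> : r = t * r + (1 - t) * r by ring.
by rewrite lerD// ler_wpM2l ?subr_ge0.
Qed.

(** The subtracted term is the exact convexity defect of the squared norm, the source of strong
    convexity below. *)
Lemma dotp_conv x y t : let z := t *: x + (1 - t) *: y in
  dotp z z = t * dotp x x + (1 - t) * dotp y y
             - t * (1 - t) * dotp (y - x) (y - x).
Proof. by rewrite /= !dotpE (dotpC y x); ring. Qed.

Definition convex_fun (h : 'rV[R]_n -> R) := forall x y t, 0 <= t <= 1 ->
  h (t *: x + (1 - t) *: y) <= t * h x + (1 - t) * h y.

Lemma convex_fun_max (h1 h2 : 'rV[R]_n -> R) :
  convex_fun h1 -> convex_fun h2 -> convex_fun (fun x => Num.max (h1 x) (h2 x)).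
Proof.
move=> c1 c2 x y t t01; have /andP[t0 t1] := t01.
have u0 : 0 <= 1 - t by rewrite subr_ge0.
rewrite ge_max; apply/andP; split.
  apply: le_trans (c1 _ _ _ t01) _.
  by rewrite lerD// ler_wpM2l// le_max lexx.
apply: le_trans (c2 _ _ _ t01) _.
by rewrite lerD// ler_wpM2l// le_max lexx orbT.
Qed.

Section add_quadratic.
Variables (h : 'rV[R]_n -> R) (mu r : R).
Hypotheses (hc : convex_fun h) (mu0 : 0 <= mu).
Let f x := h x + mu / 2 * dotp x x.

Lemma add_quadratic_conv x y t : 0 <= t <= 1 ->
  f (t *: x + (1 - t) *: y)
    <= t * f x + (1 - t) * f y - mu / 2 * (t * (1 - t)) * norm2 (y - x) ^+ 2.
Proof.
by move=> /(hc x y); rewrite /f dotp_conv sqr_norm2; lra.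
Qed.

Lemma add_quadratic_convex : convex_function (@ball2 R n r) f.
Proof.
move=> t x y _ _; rewrite convRE.
have t01 : (0 : R) <= t%:num <= 1 by rewrite ge0 le1.
apply: le_trans (add_quadratic_conv x y _ t01) _.
have [a0 a1] := andP t01.
have q0 : 0 <= mu / 2 * (t%:num * (1 - t%:num)) * norm2 (y - x : 'rV[R]_n) ^+ 2.
  by rewrite !mulr_ge0 ?norm2_ge0 ?subr_ge0 ?invr_ge0.
by rewrite /unstable.onem lerBlDr lerDl; exact: q0.
Qed.

(* Compare the subgradient inequality at x + t (y - x) with convexity along the
   segment, divide by t and let t tend to 0. *)
Lemma add_quadratic_strongly_convex : strongly_convex (@ball2 R n r) mu f.
Proof.
move=> x y s Sx Sy sub.
have key t : 0 < t -> t <= 1 ->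
    f x + dotp s (y - x) + mu / 2 * (1 - t) * norm2 (y - x) ^+ 2 <= f y.
  move=> t0 t1; have t01 : 0 <= 1 - t <= 1 by apply/andP; split; lra.
  have := add_quadratic_conv x y _ t01.
  have := sub _ (ball2_conv _ _ _ _ t01 Sx Sy).
  have -> : (1 - t) *: x + (1 - (1 - t)) *: y - x = t *: (y - x).
    by apply/rowP => i; rewrite !mxE; ring.
  rewrite dotpZr => h1 h2; rewrite -(ler_pM2l t0).
  have := le_trans h1 h2; lra.
apply/ler_addgt0Pr => e e0.
set q := mu / 2 * norm2 (y - x) ^+ 2.
have q0 : 0 <= q by rewrite !mulr_ge0 ?invr_ge0 ?norm2_ge0.
(* With [t = e / (q + e)] the loss [t * q] is at most [e]. *)
have t0 : 0 < e / (q + e) by rewrite divr_gt0// ltr_wpDl.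
have t1 : e / (q + e) <= 1 by rewrite ler_pdivrMr ?mul1r ?lerDr// ltr_wpDl.
have := key _ t0 t1; set t := e / _ in t0 t1 *.
have -> : mu / 2 * (1 - t) * norm2 (y - x) ^+ 2 = q - t * q by rewrite /q; ring.
have : t * q <= e.
  rewrite /t mulrAC ler_pdivrMr; last by rewrite ltr_wpDl.
  by rewrite ler_pM2l// lerDl ltW.
lra.
Qed.

(** Squared norms differ by [dotp (x - y) (x + y)], and [x + y] has norm at most [2 r], so the
    quadratic adds [mu * r] to the slope. *)
Lemma add_quadratic_lipschitz B : 0 <= r ->
  (forall x y, h x <= h y + B * norm2 (x - y)) ->
  lipschitz2 (@ball2 R n r) (B + mu * r) f.
Proof.
move=> r0 hl.
have one x y : ball2 r x -> ball2 r y ->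
    f x - f y <= (B + mu * r) * norm2 (x - y).
  move=> Sx Sy; rewrite /f.
  have -> : dotp x x = dotp y y + dotp (x - y) (x + y).
    by rewrite !dotpE (dotpC y x); ring.
  have : dotp (x - y) (x + y) <= norm2 (x - y) * (r + r).
    apply: le_trans (dotp_le _ _) _; rewrite ler_wpM2l ?norm2_ge0//.
    by apply: le_trans (norm2D _ _) _; exact: lerD.
  move=> /(ler_wpM2l mu0); have := hl x y; lra.
move=> x y Sx Sy; rewrite ler_norml lerNl opprB !one//=.
by rewrite -[X in _ <= _ * X]norm2N opprB one.
Qed.

End add_quadratic.
End Euclidean.

(** * The hard functions *)

Section HardInstance.
Context {R : realType} {n : nat}.
Implicit Types (u v x y : 'rV[R]_n) (tau lam G kap mu : R).

Definition equator v tau : set 'rV[R]_n :=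
  [set u | norm2 u <= 1 /\ `|dotp v u| <= tau].

Definition equator_support v tau y : R :=
  sup [set dotp u y | u in equator v tau].

Lemma equator_support_ub v tau u y :
  equator v tau u -> dotp u y <= equator_support v tau y.
Proof.
move=> Ku; apply: ub_le_sup; last by exists u.
exists (norm2 y) => _ [w [w1 _] <-]; apply: le_trans (dotp_le _ _) _.
by rewrite ler_piMl ?norm2_ge0.
Qed.

Lemma equator_support_le v tau y b : 0 <= tau ->
  (forall u, equator v tau u -> dotp u y <= b) -> equator_support v tau y <= b.
Proof.
move=> tau0 Kb; apply: ge_sup => [|_ [u /Kb ub <-]//].
by exists (dotp 0 y), 0 => //; split; rewrite ?norm20 ?dotp0r ?normr0.
Qed.

Lemma equator_support_lipschitz v tau x y : 0 <= tau ->
  equator_support v tau x <= equator_support v tau y + norm2 (x - y).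
Proof.
move=> tau0; apply: equator_support_le => // u Ku.
rewrite -(subrK y x) dotpDr addrC lerD ?equator_support_ub// subrK.
by apply: le_trans (dotp_le _ _) _; case: Ku => u1 _; rewrite ler_piMl ?norm2_ge0.
Qed.

Lemma equator_support_convex v tau : 0 <= tau ->
  convex_fun (equator_support v tau).
Proof.
move=> tau0 x y t /andP[t0 t1]; apply: equator_support_le => // u Ku.
by rewrite dotpDr !dotpZr lerD// ler_wpM2l ?subr_ge0// equator_support_ub.
Qed.

(** Cauchy-Schwarz bounds the supremum by the norm; for [y] nonzero the condition says that the
    normalised [y] lies in [equator v tau], where the norm is attained. *)
Lemma equator_support_near v tau y : 0 <= tau ->
  `|dotp v y| <= tau * norm2 y -> equator_support v tau y = norm2 y.
Proof.
move=> tau0 vy; apply/eqP; rewrite eq_le; apply/andP; split.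
  apply: equator_support_le => // u [u1 _].
  by apply: le_trans (dotp_le _ _) _; rewrite ler_piMl ?norm2_ge0.
have [y0|y0] := eqVneq (norm2 y) 0.
  have -> : norm2 y = dotp 0 y by rewrite y0 dotpC dotp0r.
  by apply: equator_support_ub; split; rewrite ?norm20 ?dotp0r ?normr0.
have yp : 0 < norm2 y by rewrite lt_def y0 norm2_ge0.
have {1}-> : norm2 y = dotp ((norm2 y)^-1 *: y) y.
  by rewrite dotpZl -sqr_norm2 expr2 mulKf.
apply: equator_support_ub; split.
  by rewrite norm2Z ger0_norm ?invr_ge0 ?norm2_ge0// mulVf.
by rewrite dotpZr normrM ger0_norm ?invr_ge0 ?norm2_ge0// ler_pdivrMl// mulrC.
Qed.

Lemma equator_support_axis v tau a : 0 <= tau -> 0 <= a ->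
  equator_support v tau (a *: v) <= a * tau.
Proof.
move=> tau0 a0; apply: equator_support_le => // u [_ uv].
by rewrite dotpZr ler_wpM2l// dotpC (le_trans (ler_norm _)).
Qed.

(* Near the hyperplane orthogonal to v, the tilt can win the maximum only at
   distance O(G / kap) from the origin, where it is small. *)
Definition hard_max lam G kap v tau y : R :=
  Num.max (- lam * dotp v y) (- G + kap * equator_support v tau y).

Definition hard_fun lam G kap mu v tau y : R :=
  hard_max lam G kap v tau y + mu / 2 * dotp y y.

(** The answer that hides [v]: the tilt is replaced by 0 and the support function by the norm. *)
Definition masked_fun lam G kap mu y : R :=
  Num.max 0 (- G + kap * norm2 y) + mu / 2 * dotp y y.

Lemma hard_max_convex lam G kap v tau : 0 <= kap -> 0 <= tau ->
  convex_fun (hard_max lam G kap v tau).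
Proof.
move=> kap0 tau0; apply: convex_fun_max => x y t t01.
  by rewrite !dotpE; lra.
have := ler_wpM2l kap0 (equator_support_convex v tau tau0 x y t t01); lra.
Qed.

Lemma hard_max_lipschitz lam G kap v tau B : norm2 v <= 1 -> 0 <= tau ->
  0 <= lam <= B -> 0 <= kap <= B ->
  forall x y, hard_max lam G kap v tau x
              <= hard_max lam G kap v tau y + B * norm2 (x - y).
Proof.
move=> v1 tau0 /andP[lam0 lamB] /andP[kap0 kapB] x y; rewrite /hard_max.
have nxy := norm2_ge0 (x - y).
have lamE := ler_wpM2r nxy lamB; have kapE := ler_wpM2r nxy kapB.
rewrite ge_max; apply/andP; split.
  have h1 : - lam * dotp v x <= - lam * dotp v y + B * norm2 (x - y).
    have : dotp v (y - x) <= norm2 (x - y).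
      apply: le_trans (dotp_le _ _) _; rewrite -(norm2N (x - y)) opprB.
      by rewrite ler_piMl ?norm2_ge0.
    by move=> /(ler_wpM2l lam0); rewrite !dotpE; lra.
  by apply: le_trans h1 _; rewrite lerD2r le_max lexx.
have h2 : - G + kap * equator_support v tau x
    <= - G + kap * equator_support v tau y + B * norm2 (x - y).
  have := ler_wpM2l kap0 (equator_support_lipschitz v tau x y tau0); lra.
by apply: le_trans h2 _; rewrite lerD2r le_max lexx orbT.
Qed.

Lemma hard_fun_LipSC lam G kap mu v tau B M r : norm2 v <= 1 -> 0 <= tau ->
  0 <= lam <= B -> 0 <= kap <= B -> 0 <= mu -> 0 <= r -> B + mu * r <= M ->
  LipSC M mu r (hard_fun lam G kap mu v tau).
Proof.
move=> v1 tau0 lamB kapB mu0 r0 BM.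
have kap0 : 0 <= kap by case/andP: kapB.
have hc := hard_max_convex lam G kap v tau kap0 tau0.
split; first exact: add_quadratic_convex.
  move=> x y Sx Sy.
  have := add_quadratic_lipschitz _ _ r mu0 B r0
    (hard_max_lipschitz lam G kap v tau B v1 tau0 lamB kapB) x y Sx Sy.
  by move=> /le_trans; apply; rewrite ler_wpM2r ?norm2_ge0.
exact: add_quadratic_strongly_convex.
Qed.

Section near_hyperplane.
Variables (lam G kap mu tau : R) (v y : 'rV[R]_n).
Hypotheses (lam0 : 0 <= lam) (G0 : 0 <= G) (kap0 : 0 < kap) (mu0 : 0 <= mu).
Hypotheses (tau0 : 0 <= tau) (lamkap : 2 * (lam * tau) <= kap).
Hypothesis (vy : `|dotp v y| <= tau * norm2 y).
(** The tilt is at most [lam * tau * norm2 y]; this is its bound at [norm2 y = 2 * G / kap], beyond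
    which the cone dominates. *)
Let delta := 2 * (lam * tau) * G / kap.

Let tilt_le : `|- lam * dotp v y| <= lam * tau * norm2 y.
Proof. by rewrite mulNr normrN normrM ger0_norm// -mulrA ler_wpM2l. Qed.

Let tilt_small : kap * norm2 y <= 2 * G -> `|- lam * dotp v y| <= delta.
Proof.
move=> yG; apply: le_trans tilt_le _; rewrite /delta ler_pdivlMr//.
have lt0 : 0 <= lam * tau by rewrite mulr_ge0.
have := ler_wpM2l lt0 yG; lra.
Qed.

Let cone_wins : 2 * G < kap * norm2 y ->
  `|- lam * dotp v y| <= - G + kap * norm2 y.
Proof.
move=> yG; apply: le_trans tilt_le _.
have := ler_wpM2r (norm2_ge0 y) lamkap; lra.
Qed.

Let cone_or_tilt : kap * norm2 y <= 2 * G \/ 2 * G < kap * norm2 y.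
Proof. by case: leP; [left|right]. Qed.

Lemma hard_fun_near_masked :
  `|masked_fun lam G kap mu y - hard_fun lam G kap mu v tau y| <= delta.
Proof.
have d0 : 0 <= delta by rewrite /delta !mulr_ge0 ?invr_ge0// ltW.
rewrite /masked_fun /hard_fun /hard_max equator_support_near//.
set p : R := - lam * dotp v y; set q : R := - G + kap * norm2 y.
have -> (A B C : R) : A + C - (B + C) = A - B by ring.
have [yG|yG] := cone_or_tilt; last first.
  have := cone_wins yG; rewrite -/p -/q ler_norml => /andP[_ pq].
  have q0 : 0 <= q by rewrite /q; have := G0; lra.
  by rewrite !max_r// subrr normr0.
(* Replacing a tilt of size at most [delta] by 0 moves the maximum by at most [delta]. *)
have := tilt_small yG; rewrite -/p !ler_norml => /andP[p1 p2].
by rewrite /Num.max; case: ifP => c1; case: ifP => c2;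
  apply/andP; split; move/negP/negP: c1 c2 => //; rewrite -?leNgt; lra.
Qed.

Lemma hard_fun_near_ge : - delta <= hard_fun lam G kap mu v tau y.
Proof.
have d0 : 0 <= delta by rewrite /delta !mulr_ge0 ?invr_ge0// ltW.
have q0 : 0 <= mu / 2 * dotp y y.
  by rewrite mulr_ge0 ?dotp_ge0// divr_ge0.
suff : - delta <= hard_max lam G kap v tau y by rewrite /hard_fun; lra.
rewrite /hard_max equator_support_near// le_max.
have [yG|yG] := cone_or_tilt.
  by have := tilt_small yG; rewrite ler_norml => /andP[-> _].
by apply/orP; right; have := G0; lra.
Qed.

End near_hyperplane.

Lemma hard_fun_axis lam G kap mu v tau a : norm2 v = 1 -> 0 <= tau ->
  0 <= kap -> 0 <= a ->
  hard_fun lam G kap mu v tau (a *: v)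
    <= Num.max (- (lam * a)) (- G + kap * tau * a) + mu / 2 * a ^+ 2.
Proof.
move=> v1 tau0 kap0 a0; rewrite /hard_fun /hard_max !dotpE -!sqr_norm2 v1.
rewrite expr1n !mulr1 -expr2 lerD2r ge_max mulNr !le_max lexx/=.
apply/orP; right; rewrite lerD2l -mulrA ler_wpM2l//.
by rewrite mulrC equator_support_axis.
Qed.

(** Ensures that [inf] over the ball is a genuine infimum and not a default value. *)
Lemma hard_fun_bounded_below lam G kap mu v tau r x : norm2 v <= 1 ->
  0 <= lam -> 0 <= mu -> ball2 r x ->
  - (lam * r) <= hard_fun lam G kap mu v tau x.
Proof.
move=> v1 lam0 mu0 xr.
have q0 : 0 <= mu / 2 * dotp x x by rewrite mulr_ge0 ?dotp_ge0// divr_ge0.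
suff : - (lam * r) <= hard_max lam G kap v tau x by rewrite /hard_fun; lra.
rewrite /hard_max le_max; apply/orP; left; rewrite mulNr lerN2 ler_wpM2l//.
apply: le_trans (dotp_le _ _) _; apply: le_trans xr.
by rewrite ler_piMl ?norm2_ge0.
Qed.

End HardInstance.

(** * Random sign vectors *)

Section CoshBound.
Context {R : realType}.
Implicit Types x z : R.

Let ch x : R := (expR x + expR (- x)) / 2.

Let ch_ge1 x : 1 <= ch x.
Proof.
have := expR_gt0 x; rewrite /ch expRN => e0.
rewrite ler_pdivlMr// mul1r -subr_ge0 -(pmulr_rge0 _ e0).
rewrite mulrBr mulrDr mulfV ?gt_eqF//.
have := sqr_ge0 (expR x - 1); rewrite expr2; lra.
Qed.

(** With [C = ch x], [ch (2 * x) = 2 C^2 - 1 <= C^4] because [(C^2 - 1)^2 >= 0]. The power 4 matches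
    the growth of [2 * x ^+ 2] under doubling. *)
Let ch_double x : ch (2 * x) <= ch x ^+ 4.
Proof.
have -> : ch (2 * x) = 2 * ch x ^+ 2 - 1.
  rewrite /ch -mulrN !expRM_natl !expRN.
  by have := expR_gt0 x; move: (expR x) => e e0; field; rewrite gt_eqF.
have := sqr_ge0 (ch x ^+ 2 - 1); rewrite expr2; lra.
Qed.

(** The bounds [1 / (1 - z)] and [1 / (1 + z)] on the two exponentials average to [1 / (1 - z^2)],
    at most [1 + 2 z^2] when [z^2 <= 1/4]. *)
Let ch_small z : `|z| <= 1 / 2 -> ch z <= expR (2 * z ^+ 2).
Proof.
rewrite ler_norml => /andP[z1 z2].
have e1 : expR z <= (1 - z)^-1.
  rewrite -[leLHS]invrK -expRN lef_pV2 ?posrE ?expR_gt0//; last by lra.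
  exact: expR_ge1Dx.
have e2 : expR (- z) <= (1 + z)^-1.
  rewrite expRN lef_pV2 ?posrE ?expR_gt0//; last by lra.
  exact: expR_ge1Dx.
apply: (le_trans _ (expR_ge1Dx _)); rewrite /ch ler_pdivrMr//.
apply: le_trans (lerD e1 e2) _.
have -> : (1 - z)^-1 + (1 + z)^-1 = 2 / (1 - z ^+ 2).
  have p1 : 1 - z != 0 by rewrite gt_eqF//; lra.
  have p2 : 1 + z != 0 by rewrite gt_eqF//; lra.
  have p3 : 1 - z ^+ 2 != 0.
    rewrite (_ : 1 - z ^+ 2 = (1 - z) * (1 + z)) ?mulf_neq0//; ring.
  by field; rewrite p1 p2 p3.
have zz : z ^+ 2 <= 1 / 4 by nra.
have zz0 := sqr_ge0 z.
rewrite ler_pdivrMr; last by lra.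
nra.
Qed.

(* By doubling, cosh (2 ^ k z) <= cosh z ^ (4 ^ k): the quadratic bound
   propagates from a neighbourhood of 0 to the whole line. *)
Lemma expR_sym_le x : expR x + expR (- x) <= 2 * expR (2 * x ^+ 2).
Proof.
suff : ch x <= expR (2 * x ^+ 2) by rewrite /ch ler_pdivrMr// mulrC.
have [k xk] : exists k, `|x| <= 2 ^+ k / 2.
  exists (Num.bound (2 * `|x|)); have := archi_boundP (_ : 0 <= 2 * `|x|).
  rewrite mulr_ge0// => /(_ isT) h.
  have := ltnW (ltn_expl (Num.bound (2 * `|x|)) (ltnSn 1)).
  by rewrite -(ler_nat R) natrX => /(lt_le_trans h); lra.
elim: k x xk => [|k IHk] x xk; first by apply: ch_small; rewrite -(expr0 2).
have {1}-> : x = 2 * (x / 2) by field.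
apply: le_trans (ch_double _) _.
have xk' : `|x / 2| <= 2 ^+ k / 2.
  by rewrite normrM (ger0_norm (_ : 0 <= 2^-1))//; move: xk; rewrite exprS; lra.
have := IHk _ xk'; rewrite -(ler_pXn2r (_ : 0 < 4)%N) ?nnegrE ?expR_ge0//.
  move=> /le_trans; apply; rewrite -expRM_natl ler_expR.
  by rewrite le_eqVlt; apply/orP; left; apply/eqP; field.
exact: le_trans (ch_ge1 _).
Qed.

End CoshBound.

Section RandomSigns.
Context {R : realType} {n : nat}.
Hypothesis n0 : (0 < n)%N.
Implicit Types (y : 'rV[R]_n) (t : R).

Definition sign_vector (b : {ffun 'I_n -> bool}) : 'rV[R]_n :=
  \row_i ((-1) ^+ b i / Num.sqrt n%:R).

Let nR0 : 0 < n%:R :> R. Proof. by rewrite ltr0n. Qed.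

Lemma norm2_sign_vector b : norm2 (sign_vector b) = 1.
Proof.
rewrite /norm2 /dotp (eq_bigr (fun=> n%:R^-1)).
  by rewrite sumr_const card_ord -[_ *+ n]mulr_natl mulfV ?sqrtr1 ?gt_eqF.
move=> i _; rewrite mxE mulrACA -!expr2 sqrr_sign exprVn sqr_sqrtr ?mul1r ?ltW//.
Qed.

(** An unnormalised moment generating function: by independence of the signs it factors over
    coordinates, and [expR_sym_le] bounds each factor. *)
Lemma sum_expR_dotp_sign_vector y t :
  \sum_b expR (t * dotp (sign_vector b) y)
    <= 2 ^+ n * expR (2 * t ^+ 2 * norm2 y ^+ 2 / n%:R).
Proof.
pose F i (c : bool) := expR (t * ((-1) ^+ c / Num.sqrt n%:R * y 0 i)).
have -> : \sum_b expR (t * dotp (sign_vector b) y) = \prod_i \sum_c F i c.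
  rewrite bigA_distr_bigA; apply: eq_bigr => b _.
  rewrite mulr_sumr expR_sum; apply: eq_bigr => i _.
  by rewrite /F mxE.
have -> : 2 ^+ n * expR (2 * t ^+ 2 * norm2 y ^+ 2 / n%:R)
   = \prod_(i < n) (2 * expR (2 * (t * (y 0 i / Num.sqrt n%:R)) ^+ 2)).
  rewrite big_split/= prodr_const card_ord -expR_sum sqr_norm2.
  congr (_ * expR _); rewrite mulr_sumr mulr_suml; apply: eq_bigr => i _.
  rewrite !exprMn exprVn sqr_sqrtr ?ltW//; ring.
apply: ler_prod => i _; rewrite big_bool /F /= addr_ge0 ?expR_ge0//=.
have := expR_sym_le (t * (y 0 i / Num.sqrt n%:R)).
rewrite expr1 expr0 addrC.
congr (expR _ + expR _ <= _); ring.
Qed.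

Lemma card_dotp_sign_vector_gt y tau : 0 <= tau ->
  #|[pred b | tau * norm2 y < dotp (sign_vector b) y]|%:R
    <= 2 ^+ n * expR (- (n%:R * tau ^+ 2 / 8)).
Proof.
move=> tau0; set B := [pred b | _].
have [y0|y0] := eqVneq (norm2 y) 0.
  rewrite eq_card0 ?mulr_ge0 ?exprn_ge0 ?expR_ge0// => b.
  by rewrite inE y0 mulr0 (norm2_eq0 y y0) dotp0r ltxx.
have yp : 0 < norm2 y by rewrite lt_def y0 norm2_ge0.
(* Chernoff bound: this [t] minimises [2 t^2 |y|^2 / n - t tau |y|], with minimum
   [- n tau^2 / 8]. *)
pose t := n%:R * tau / (4 * norm2 y).
have t0 : 0 <= t by rewrite !mulr_ge0 ?invr_ge0 ?mulr_ge0 ?norm2_ge0.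
have : #|B|%:R * expR (t * (tau * norm2 y))
    <= 2 ^+ n * expR (2 * t ^+ 2 * norm2 y ^+ 2 / n%:R).
  apply: le_trans (sum_expR_dotp_sign_vector y t).
  rewrite mulr_natl -sumr_const [leRHS](bigID (mem B))/= -[leLHS]addr0.
  apply: lerD; last by apply: sumr_ge0 => b _; exact: expR_ge0.
  apply: ler_sum => b; rewrite inE => bB.
  by rewrite ler_expR ler_wpM2l// ltW.
rewrite -ler_pdivlMr ?expR_gt0// => /le_trans; apply.
rewrite -[leLHS]mulrA -expRN -expRD le_eqVlt; apply/orP; left; apply/eqP.
congr (_ * expR _); rewrite /t; field.
by rewrite y0 gt_eqF.
Qed.

Definition near_hyperplane tau b y : bool :=
  `|dotp (sign_vector b) y| <= tau * norm2 y.

Lemma card_not_near_hyperplane y tau : 0 <= tau ->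
  #|[pred b | ~~ near_hyperplane tau b y]|%:R
    <= 2 * (2 ^+ n * expR (- (n%:R * tau ^+ 2 / 8))).
Proof.
move=> tau0; rewrite mulr_natl mulr2n.
have := lerD (card_dotp_sign_vector_gt y tau tau0)
             (card_dotp_sign_vector_gt (- y) tau tau0).
apply: le_trans; rewrite -natrD ler_nat -cardUI.
apply: leq_trans (leq_addr _ _); apply: subset_leq_card.
apply/fintype.subsetP => b; rewrite !inE -ltNge norm2N dotpNr.
by rewrite lter_normr.
Qed.

End RandomSigns.

(** * Oracles hiding a random instance *)

(** The sum of the probabilities is the expected number of events that occur, and that number is at
    most [N] pointwise. *)
Lemma sum_probability_le (R : realType) (d : measure_display)
    (W : measurableType d) (P : probability W R) (I : finType)
    (E : I -> set W) (N : R) :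
  (forall i, measurable (E i)) ->
  (forall w, #|[pred i | `[< E i w >]]|%:R <= N) ->
  (\sum_i P (E i) <= N%:E)%E.
Proof.
move=> mE cN.
have -> : (\sum_i P (E i) = \int[P]_w \sum_i (\1_(E i) w)%:E)%E.
  rewrite ge0_integral_sum//.
    by apply: eq_bigr => i _; rewrite integral_indic// setIT.
  by move=> i; exact/measurable_EFinP/measurable_indic.
have -> : N%:E = (\int[P]_w cst N%:E w)%E.
  rewrite integral_cst// [X in (_ * X)%E](_ : _ = 1%E) ?mule1//.
  exact: probability_setT.
apply: ge0_le_integral => //.
- by move=> w _; apply: sume_ge0 => i _; rewrite lee_fin.
- apply: emeasurable_sum => i.
  exact/measurable_EFinP/measurable_indic.
- move=> w _ /=; rewrite sumEFin lee_fin; apply: le_trans (cN w).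
  rewrite -sum1_card natr_sum le_eqVlt; apply/orP; left; apply/eqP.
  rewrite [RHS]big_mkcond/=.
  apply: eq_bigr => i _; rewrite indicE inE.
  have [Ei|Ei] := pselect (E i w).
    by rewrite mem_set// asboolT.
  by rewrite memNset// asboolF.
Qed.

Section Adversary.
Context {R : realType} {X : Type} {B : finType}.
Variables (S : set X) (near : B -> X -> bool) (O : B -> X -> R) (g : X -> R).
Variable N : R.
Hypothesis N_card : forall x, #|[pred b | ~~ near b x]|%:R <= N.
Hypothesis O_near : forall b x, near b x -> O b x = g x.

(* As long as every query is near, the answers are those of g, so the run does
   not depend on b: union bound over the queries and the output. *)
Lemma card_run_not_near T (A : algorithm R X) : valid_algorithm S T A ->
  #|[pred b | ~~ near b (run (O b) A)]|%:R <= T.+1%:R * N.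
Proof.
have N0 : 0 <= N.
  elim: A => [x|x _ IH]; last exact: IH 0.
  by apply: le_trans (N_card x).
elim: A T => [x|x next IH] T /=.
  move=> _; apply: le_trans (N_card x) _.
  by rewrite ler_peMl// ler1n.
case: T => [//|T] [_ /(_ (g x))] /IH h.
rewrite -[T.+2]add1n natrD mulrDl mul1r.
apply: le_trans (lerD (N_card x) h).
rewrite -natrD ler_nat -cardUI; apply: leq_trans (leq_addr _ _).
apply: subset_leq_card; apply/fintype.subsetP => b; rewrite !inE.
by have [nb|//] := boolP (near b x); rewrite O_near.
Qed.

End Adversary.

(** Averaging over [b]: each instance is solved with probability at least [1 - beta], yet for a
    fixed random outcome success on [b] forces an output not near [b], which happens for at most
    [(T + 1) N] of them. *)
Lemma solves_hidden_instance (R : realType) (X : Type) (B : finType)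
    (S : set X) (F : set (X -> R)) (near : B -> X -> bool) (f : B -> X -> R)
    (g : X -> R) (eps beta delta N : R) (T : nat)
    (A : randomized_algorithm R X) :
  0 <= delta ->
  (forall b, F (f b)) ->
  (forall b x, near b x -> `|g x - f b x| <= delta) ->
  (forall b x, near b x -> eps < f b x - inf (f b @` S)) ->
  (forall x, #|[pred b | ~~ near b x]|%:R <= N) ->
  solves S F eps beta delta T A ->
  #|B|%:R * (1 - beta) <= T.+1%:R * N.
Proof.
move=> delta0 fF near_g near_gap N_card [validA solveA].
(* Falling back on [f b] where [g] is too far off keeps the oracle admissible on all of [S]; near
   points still receive [g]. *)
pose O b x := if `|g x - f b x| <= delta then g x else f b x.
have O_noisy b : noisy_oracles S delta (f b) (O b).
  by move=> x _; rewrite /O; case: ifP => // _; rewrite subrr normr0.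
have O_near b x : near b x -> O b x = g x by move=> /near_g; rewrite /O => ->.
pose E b := success S eps (f b) (O b) A.
have mE b : measurable (E b) by case: (solveA (f b) (O b) (fF b) (O_noisy b)).
have EN w : #|[pred b | `[< E b w >]]|%:R <= T.+1%:R * N.
  apply: le_trans (card_run_not_near S near O g N N_card O_near T _ (validA w)).
  rewrite ler_nat; apply: subset_leq_card; apply/fintype.subsetP => b.
  rewrite !inE => Eb; apply/negP => /near_gap; rewrite ltNge.
  by move=> /negP; apply; exact: Eb.
have := sum_probability_le R _ _ (ra_prob A) B E _ mE EN; rewrite -lee_fin.
apply: le_trans; rewrite mulr_natl -sumr_const -sumEFin.
apply: lee_sum => b _.
by case: (solveA (f b) (O b) (fF b) (O_noisy b)).
Qed.

(** The hidden instance with tilt [4 s] and depth [4 s D], where [s D] is the accuracy. The last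
    hypothesis says that the queries and the output together find too few of the sign vectors. *)
Lemma max_noise_le_tilt (R : realType) (n T : nat) (r M mu s D beta tau kap : R) :
  (0 < n)%N -> 0 < mu -> 0 < D -> mu * D = s -> D <= r ->
  2 * mu * r <= M -> 16 * s <= M ->
  0 <= tau -> 0 < kap -> kap <= M / 4 -> kap * tau <= s -> 8 * s * tau <= kap ->
  32 * s * tau < 3 / 2 * kap ->
  2 * T.+1%:R * expR (- (n%:R * tau ^+ 2 / 8)) < 1 - beta ->
  (max_noise (@ball2 R n r) (@LipSC R n M mu r) (s * D) beta T
    <= (32 * s * tau * (s * D) / kap)%:E)%E.
Proof.
move=> n0 mu0 D0 sE Dr muM sM tau0 kap0 kapM kaptau taukap gap few.
set delta0 := 32 * _ * _ * _ / _.
have s0 : 0 < s by rewrite -sE mulr_gt0.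
have sD0 : 0 < s * D by rewrite mulr_gt0.
have r0 : 0 < r by apply: lt_le_trans Dr.
have deltaE : 2 * (4 * s * tau) * (4 * (s * D)) / kap = delta0.
  by rewrite /delta0; ring.
(* Near points have value at least [- delta0] and the infimum is at most [- 5/2 s D], so this leaves
   a gap above [s D]. *)
have gapD : delta0 < 3 / 2 * (s * D).
  by rewrite /delta0 ltr_pdivrMr//; move: gap; rewrite -(ltr_pM2r sD0); lra.
apply: ge_ereal_sup => _ [delta [delta_ge0 [A solA]] <-].
rewrite lee_fin leNgt; apply/negP => delta_big.
pose f b := hard_fun (4 * s) (4 * (s * D)) kap mu (@sign_vector R n b) tau.
have s4 : 0 <= 4 * s by lra.
have sD4 : 0 <= 4 * (s * D) by lra.
have mu0' := ltW mu0.
have lamkap : 2 * (4 * s * tau) <= kap by lra.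
have v1 b : norm2 (@sign_vector R n b) <= 1 by rewrite norm2_sign_vector.
have inf_le b : inf (f b @` ball2 r) <= - (5 / 2 * (s * D)).
  have : inf (f b @` ball2 r) <= f b (D *: sign_vector b).
    apply: ge_inf; last first.
      exists (D *: sign_vector b) => //.
      by rewrite /ball2 /= norm2Z norm2_sign_vector// mulr1 ger0_norm// ltW.
    exists (- (4 * s * r)) => _ [x xr <-].
    exact: hard_fun_bounded_below.
  move=> /le_trans; apply.
  (* At [D *: sign_vector b], in units of [s D]: the tilt gives -4, the cone at most -4 + 1, and the
     quadratic 1/2. *)
  apply: le_trans (hard_fun_axis _ _ _ _ _ _ _ _ _ _ _) _ => //.
  - exact: norm2_sign_vector.
  - exact: ltW.
  - exact: ltW.
  have -> : mu / 2 * D ^+ 2 = s * D / 2 by rewrite -sE; ring.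
  have kD := ler_wpM2r (ltW D0) kaptau.
  rewrite -lerBrDr ge_max; apply/andP; split; lra.
have := solves_hidden_instance R _ {ffun 'I_n -> bool} (ball2 r)
  (@LipSC R n M mu r) (near_hyperplane tau) f
  (masked_fun (4 * s) (4 * (s * D)) kap mu) (s * D) beta delta
  (2 * (2 ^+ n * expR (- (n%:R * tau ^+ 2 / 8)))) T A.
(* Slope budget: [M / 4] for the maximum and [mu * r <= M / 2] for the quadratic. *)
have fF b : LipSC M mu r (f b).
  apply: (hard_fun_LipSC _ _ _ _ _ _ (M / 4)) => //.
  - by apply/andP; split; lra.
  - by rewrite (ltW kap0).
  - exact: ltW.
  - lra.
have near_f b x : near_hyperplane tau b x ->
    `|masked_fun (4 * s) (4 * (s * D)) kap mu x - f b x| <= delta.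
  move=> nbx; apply: le_trans _ (ltW delta_big); rewrite -deltaE.
  exact: hard_fun_near_masked.
have gap_f b x : near_hyperplane tau b x -> s * D < f b x - inf (f b @` ball2 r).
  move=> nbx; have := inf_le b.
  have : - delta0 <= f b x by rewrite -deltaE; exact: hard_fun_near_ge.
  lra.
have cardN x := card_not_near_hyperplane n0 x tau tau0.
move=> /(_ delta_ge0 fF near_f gap_f cardN solA).
rewrite card_ffun card_bool card_ord natrX.
have -> : T.+1%:R * (2 * (2 ^+ n * expR (- (n%:R * tau ^+ 2 / 8))))
  = 2 ^+ n * (2 * T.+1%:R * expR (- (n%:R * tau ^+ 2 / 8))) by ring.
by rewrite ler_pM2l ?exprn_gt0// leNgt few.
Qed.

(** * Choice of the parameters *)

Section Rates.
Context {R : realType}.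
Implicit Types (M mu eps c : R) (n : nat).

(** The square root of e is at most [1 / (1 - 1/2) = 2], so e is at most 4. *)
Lemma ln_ge1 (x : R) : 4 <= x -> 1 <= ln x.
Proof.
move=> x4; have x0 : 0 < x by lra.
rewrite -ler_expR lnK ?posrE//; apply: le_trans x4.
have -> : 1 = 2%:R * 2^-1 :> R by rewrite mulfV.
rewrite expRM_natl.
have : expR 2^-1 <= 2 :> R.
  rewrite -[leLHS]invrK -expRN -[leRHS]invrK lef_pV2 ?posrE ?expR_gt0//.
  have := expR_ge1Dx (- 2^-1 : R); lra.
have := expR_ge0 (2^-1 : R); rewrite expr2; nra.
Qed.

(** Doubling [eps] cancels the 2 in the diameter [2 * Num.sqrt (eps / mu)], so the logarithm has
    exactly the scaled dimension as argument. *)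
Lemma calR_doubled n M mu eps c : (0 < n)%N -> 0 < M -> 0 < mu -> 0 < eps ->
  calR c (2 * eps) M (2 * Num.sqrt (eps / mu)) n
  = 2 * Num.max (Num.sqrt (mu * eps) * eps / (Num.sqrt n%:R * M)) (eps / n%:R)
    * (13 * c * ln (n%:R * M / Num.sqrt (mu * eps))) ^+ 2.
Proof.
move=> n0 M0 mu0 eps0.
have nR : 0 < n%:R :> R by rewrite ltr0n.
have qn : 0 < Num.sqrt n%:R :> R by rewrite sqrtr_gt0.
have D0 : 0 < Num.sqrt (eps / mu) by rewrite sqrtr_gt0 divr_gt0.
have epsE : eps = Num.sqrt (mu * eps) * Num.sqrt (eps / mu).
  rewrite -sqrtrM ?mulr_ge0 ?ltW//.
  have -> : mu * eps * (eps / mu) = eps ^+ 2 by field; rewrite gt_eqF.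
  by rewrite sqrtr_sqr ger0_norm// ltW.
have s0 : 0 < Num.sqrt (mu * eps) by rewrite sqrtr_gt0 mulr_gt0.
rewrite /calR; set s := Num.sqrt (mu * eps) in epsE s0 *.
set D := Num.sqrt (eps / mu) in epsE D0 *; rewrite epsE.
rewrite maxr_pMr//; congr (Num.max _ _ * (13 * c * ln _) ^+ 2); field;
  by rewrite ?gt_eqF.
Qed.

Lemma mulr_powR_three_halves eps : 0 < eps -> eps `^ (3 / 2) = eps * Num.sqrt eps.
Proof.
move=> eps0; have -> : 3 / 2 = 1 + 2^-1 :> R by field.
by rewrite powRD ?gt_eqF ?implybT// powRr1 ?ltW// powR12_sqrt// ltW.
Qed.

Lemma expR_NM_ln c (Q : R) : 0 < Q -> expR (- (c * ln Q)) = (Q `^ c)^-1.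
Proof. by move=> Q0; rewrite /powR gt_eqF// expRN. Qed.

(** The constant [1 / 64] is the square of the [1 / 8] in [Num.sqrt (mu * eps) <= mu * r / 8]. *)
Lemma sqrtr_mul_le (r M mu eps : R) : 0 < mu -> 0 < r -> 0 < eps ->
  2 * mu * r <= M -> eps < 1 / 64 * mu * r ^+ 2 ->
  16 * Num.sqrt (mu * eps) <= M.
Proof.
move=> mu0 r0 eps0 muM epsr; apply: le_trans muM.
have mr0 : 0 <= mu * r / 8 by rewrite !mulr_ge0 ?ltW.
suff : Num.sqrt (mu * eps) <= mu * r / 8 by lra.
rewrite -(ler_pXn2r (_ : 0 < 2)%N) ?nnegrE ?sqrtr_ge0//.
rewrite sqr_sqrtr ?(ltW (mulr_gt0 mu0 eps0))//.
by have := ler_wpM2l (ltW mu0) (ltW epsr); lra.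
Qed.

Lemma scaled_dimension_ge n (r M mu eps : R) : (0 < n)%N -> 0 < M ->
  0 < mu -> 0 < r -> 0 < eps ->
  2 * mu * r <= M -> eps < 1 / 64 * mu * r ^+ 2 ->
  16 <= n%:R * M / Num.sqrt (mu * eps).
Proof.
move=> n0 M0 mu0 r0 eps0 muM epsr.
rewrite ler_pdivlMr ?sqrtr_gt0 ?mulr_gt0//.
apply: le_trans (sqrtr_mul_le r M mu eps mu0 r0 eps0 muM epsr) _.
by rewrite ler_peMl ?ler1n// ltW.
Qed.

Lemma max_noise_le_calR n T (r M mu eps c beta : R) :
  (0 < n)%N -> 0 < M -> 0 < mu -> 0 < r -> 0 < eps ->
  2 * mu * r <= M -> eps < 1 / 64 * mu * r ^+ 2 -> 1 <= c ->
  let Q := n%:R * M / Num.sqrt (mu * eps) in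
  8 * (c * ln Q) / n%:R <= 1 / 36 ->
  T%:R / Q `^ c <= 1 / 16 -> beta < 1 / 2 ->
  (max_noise (@ball2 R n r) (@LipSC R n M mu r) eps beta T
    <= (4 * calR c (2 * eps) M (2 * Num.sqrt (eps / mu)) n)%:E)%E.
Proof.
move=> n0 M0 mu0 r0 eps0 muM epsr c1 Q tau2 TQ beta2.
rewrite calR_doubled//.
have nR : 0 < n%:R :> R by rewrite ltr0n.
have n1 : 1 <= n%:R :> R by rewrite ler1n.
have qn : 0 < Num.sqrt n%:R :> R by rewrite sqrtr_gt0.
pose s := Num.sqrt (mu * eps); pose D := Num.sqrt (eps / mu).
have s0 : 0 < s by rewrite sqrtr_gt0 mulr_gt0.
have D0 : 0 < D by rewrite sqrtr_gt0 divr_gt0.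
have sE : mu * D = s.
  rewrite -[mu in LHS]ger0_norm ?ltW// -sqrtr_sqr -sqrtrM ?sqr_ge0//.
  by congr Num.sqrt; field; rewrite gt_eqF.
have epsE : s * D = eps.
  rewrite -sE -mulrA -expr2 sqr_sqrtr ?ltW ?divr_gt0//.
  by rewrite mulrCA mulfV ?mulr1// gt_eqF.
have Dr : D <= r.
  rewrite -(ler_pXn2r (_ : 0 < 2)%N) ?nnegrE ?(ltW D0) ?(ltW r0)//.
  rewrite /D sqr_sqrtr ?(ltW (divr_gt0 eps0 mu0))// ler_pdivrMr//.
  by have : 0 <= mu * r ^+ 2 by [rewrite mulr_ge0 ?sqr_ge0 ?ltW|]; lra.
have sM : 16 * s <= M by exact: (sqrtr_mul_le r).
have Q16 : 16 <= Q by exact: (scaled_dimension_ge n r).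
have Q0 : 0 < Q by lra.
have Q1 : 1 <= Q by lra.
have L1 : 1 <= ln Q by apply: ln_ge1; lra.
pose w := c * ln Q; have w1 : 1 <= w by rewrite /w; nra.
(* Chosen so that [n tau^2 / 8 = c ln Q], which turns the tail bound into [Q^-c]. *)
pose tau := Num.sqrt (8 * w / n%:R).
have tau0 : 0 < tau by rewrite sqrtr_gt0 divr_gt0//; lra.
have tauE : tau ^+ 2 = 8 * w / n%:R by rewrite sqr_sqrtr// ltW// divr_gt0//; lra.
have tau6 : tau <= 1 / 6.
  rewrite -(ler_pXn2r (_ : 0 < 2)%N) ?nnegrE ?(ltW tau0)// ?divr_ge0//.
  by rewrite tauE (le_trans tau2)// expr2; lra.
(* Since [w >= 1], [8 w] may replace its square root; the rate contains [w ^+ 2], which absorbs the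
   loss. *)
have tau_le : tau <= 8 * w / Num.sqrt n%:R.
  rewrite -(ler_pXn2r (_ : 0 < 2)%N) ?nnegrE ?(ltW tau0)//; last first.
    by rewrite divr_ge0//; lra.
  rewrite tauE expr_div_n sqr_sqrtr ?(ltW nR)// ler_pM2r ?invr_gt0//.
  by rewrite expr2; nra.
pose kap := Num.min (M / 4) (s / tau).
have kap0 : 0 < kap by rewrite lt_min !divr_gt0.
have tau36 : tau * tau <= 1 / 36 by nra.
apply: le_trans (_ : (32 * s * tau * eps / kap)%:E <= _)%E; last first.
  rewrite lee_fin -/s -/Q.
  set m := Num.max _ _.
  have m1 : s * eps / (Num.sqrt n%:R * M) <= m by rewrite le_max lexx.
  have m2 : eps / n%:R <= m by rewrite le_max lexx orbT.
  have m0 : 0 <= m by apply: le_trans m2; rewrite divr_ge0// ltW.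
  have -> : (13 * c * ln Q) ^+ 2 = 169 * w ^+ 2 by rewrite /w; ring.
  have w2 : w <= w ^+ 2 by rewrite expr2; nra.
  have wm : w * m <= w ^+ 2 * m by rewrite ler_wpM2r.
  have w0 : 0 <= w by lra.
  have wm0 : 0 <= w * m by rewrite mulr_ge0.
  (* Slope [M / 4] yields the first term of the maximum, slope [s / tau] the second. *)
  rewrite /kap minEle; case: ifP => _.
    apply: le_trans (_ : 1024 * (w * (s * eps / (Num.sqrt n%:R * M))) <= _).
      have -> : 32 * s * tau * eps / (M / 4) = 128 * s * eps / M * tau.
        by field; rewrite gt_eqF.
      have -> : 1024 * (w * (s * eps / (Num.sqrt n%:R * M)))
          = 128 * s * eps / M * (8 * w / Num.sqrt n%:R).
        by field; rewrite !gt_eqF.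
      by rewrite ler_wpM2l// !mulr_ge0 ?invr_ge0 ?ltW.
    have := ler_wpM2l w0 m1; lra.
  have -> : 32 * s * tau * eps / (s / tau) = 256 * (w * (eps / n%:R)).
    have -> : 32 * s * tau * eps / (s / tau) = 32 * eps * tau ^+ 2.
      by field; rewrite !gt_eqF.
    by rewrite tauE; field; rewrite gt_eqF.
  have := ler_wpM2l w0 m2; lra.
have stau : s * tau <= s * (1 / 6) by rewrite ler_wpM2l// ltW.
have stau2 : s * (tau * tau) <= s * (1 / 36) by rewrite ler_wpM2l// ltW.
have := max_noise_le_tilt R n T r M mu s D beta tau kap n0 mu0 D0 sE.
rewrite epsE; apply => //.
- exact: ltW.
- by rewrite ge_min lexx.
- by rewrite -ler_pdivlMr// ge_min lexx orbT.
- by rewrite le_min (ler_pdivlMr _ _ tau0); apply/andP; split; lra.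
(* For slope [M / 4 >= 4 s] use [tau <= 1/6]; for slope [s / tau] use [tau^2 <= 1/36]. *)
- suff : 64 / 3 * (s * tau) < kap by lra.
  by rewrite lt_min (ltr_pdivlMr _ _ tau0); apply/andP; split; lra.
have -> : n%:R * tau ^+ 2 / 8 = c * ln Q.
  by rewrite tauE /w; field; rewrite gt_eqF.
rewrite expR_NM_ln//.
(* Then [2 (T + 1) / Q^c <= 1/8 + 1/8], below [1/2 < 1 - beta]. *)
have Qc : 16 <= Q `^ c.
  apply: le_trans Q16 _; rewrite -[leLHS]powRr1 ?(ltW Q0)// ler_powR//.
have Qc0 : 0 < Q `^ c by rewrite powR_gt0.
have : (Q `^ c)^-1 <= 16^-1 by rewrite lef_pV2 ?posrE.
have -> : 2 * T.+1%:R / Q `^ c = 2 * (T%:R / Q `^ c) + 2 * (Q `^ c)^-1.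
  by rewrite -addn1 natrD; ring.
lra.
Qed.

(** As [c ln Q >= 1], the squared factor in [frakA] is at least [169 c ln Q], and the maximum is at
    least [1 / n]; finally [8 / 338 < 1 / 36]. *)
Lemma frakA_small (Clog c M mu eps creg : R) n : (0 < n)%N ->
  let Q := n%:R * M / Num.sqrt (mu * eps) in
  4 <= Q -> 2 <= Clog -> creg <= 1 / 2 -> 1 <= c ->
  frakA Clog c M mu eps n <= creg -> 8 * (c * ln Q) / n%:R <= 1 / 36.
Proof.
move=> n0 Q Q4 Clog2 creg2 c1; rewrite /frakA.
set m := Num.max _ _.
have nR : 0 < n%:R :> R by rewrite ltr0n.
have -> : Clog * n%:R * M / Num.sqrt (mu * eps) = Clog * Q by rewrite /Q; ring.
have L1 : 1 <= ln Q by apply: ln_ge1.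
have LL : ln Q <= ln (Clog * Q) by rewrite ler_ln ?posrE//; nra.
have m1 : n%:R^-1 <= m by rewrite le_max lexx orbT.
have ni : 0 < n%:R^-1 :> R by rewrite invr_gt0.
move=> h; suff : 169 * (c * ln Q) / n%:R <= 1 / 2 by lra.
apply: le_trans creg2; apply: le_trans h.
apply: ler_pM => //; first by nra.
have cL : c * ln Q <= c * ln (Clog * Q) by rewrite ler_wpM2l//; lra.
have : 1 <= c * ln Q by nra.
move: (c * ln Q) cL => a; rewrite -mulrA.
move: (c * ln (Clog * Q)) => b ab a1.
by rewrite exprMn expr2 expr2; nra.
Qed.

End Rates.

(** * The noise bound along a sequence of parameters *)

Theorem mainTheorem3 (R : realType) :
  exists Cbar cbar : R, 2 <= Cbar /\ 0 < cbar /\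
  forall Clog creg : R, Cbar <= Clog -> 0 < creg -> creg <= cbar ->
  forall c : R, 1 <= c ->
  exists (C0 C1 c0 : R) (n0 : nat) (C2 : R) (p : nat),
    [/\ 0 < C0, 0 < C1, 0 < c0, (0 < n0)%N & 0 < C2] /\
    forall beta : R, 0 < beta -> beta < 1 / 2 ->
    forall (n : nat -> nat) (M mu r eps : nat -> R) (T : nat -> nat),
      n k @[k --> \oo] --> \oo ->
      (forall k, (n0 <= n k)%N) ->
      (forall k, [/\ 0 < M k, 0 < mu k & 0 < r k]) ->
      (forall k, C1 * mu k * r k <= M k) ->
      (forall k, 0 < eps k /\ eps k < c0 * mu k * r k ^+ 2) ->
      (forall k, frakA Clog c (M k) (mu k) (eps k) (n k) <= creg) ->
      (T k)%:R / ((n k)%:R * M k / Num.sqrt (mu k * eps k)) `^ c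
        @[k --> \oo] --> (0 : R) ->
      (\forall k \near \oo,
        (max_noise (@ball2 R (n k) (r k)) (@LipSC R (n k) (M k) (mu k) (r k))
           (eps k) beta (T k)
         <= (C0 * calR c (C1 * eps k) (M k)
                    (2 * Num.sqrt (eps k / mu k)) (n k))%:E)%E) /\
      (\forall k \near \oo,
        (max_noise (@ball2 R (n k) (r k)) (@LipSC R (n k) (M k) (mu k) (r k))
           (eps k) beta (T k)
         <= (C2 * ln ((n k)%:R * M k / Num.sqrt (mu k * eps k)) ^+ p *
             Num.max
               (Num.sqrt (mu k) * eps k `^ (3 / 2)
                  / (Num.sqrt (n k)%:R * M k))
               (eps k / (n k)%:R))%:E)%E).
Proof.
exists 2, (1 / 2); do 2!split => //.
move=> Clog creg Clog2 creg0 creg2 c c1.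
(* [1352 c^2 = 4 * 2 * (13 c)^2] collects the constants of [4 * calR] after [calR_doubled]; the
   exponent 2 is that of its logarithm. *)
exists 4, 2, (1 / 64), 1%N, (1352 * c ^+ 2), 2%N; split.
  have c0 : 0 < c by lra.
  by split; rewrite ?mulr_gt0 ?exprn_gt0 ?invr_gt0 ?ltr0n ?c0.
move=> beta beta0 beta2 n M mu r eps T _ n1 pos muM epsr fA TQ.
have main : \forall k \near \oo,
    (max_noise (@ball2 R (n k) (r k)) (@LipSC R (n k) (M k) (mu k) (r k))
       (eps k) beta (T k)
     <= (4 * calR c (2 * eps k) (M k)
                (2 * Num.sqrt (eps k / mu k)) (n k))%:E)%E.
  have T16 : \forall k \near \oo,
      `|(T k)%:R / ((n k)%:R * M k / Num.sqrt (mu k * eps k)) `^ c| <= 1 / 16.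
    by apply: (cvgr0_norm_le _ TQ).
  near=> k.
  have [M0 mu0 r0] := pos k; have [eps0 epsk] := epsr k.
  apply: max_noise_le_calR => //.
    apply: frakA_small (fA k) => //.
    have := scaled_dimension_ge _ _ _ _ _ (n1 k) M0 mu0 r0 eps0 (muM k) epsk.
    by apply: le_trans; rewrite ler_nat.
  by apply: le_trans (ler_norm _) _; near: k.
split=> //; apply: filterS main => k /le_trans; apply.
have [M0 mu0 r0] := pos k; have [eps0 _] := epsr k.
rewrite calR_doubled//.
have -> : Num.sqrt (mu k) * eps k `^ (3 / 2) = Num.sqrt (mu k * eps k) * eps k.
  by rewrite mulr_powR_three_halves// sqrtrM ?ltW//; ring.
rewrite lee_fin le_eqVlt; apply/orP; left; apply/eqP.
by set m := Num.max _ _; ring.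
Unshelve. all: by end_near.
Qed.
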